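(* Let $\kappa$ be a regular uncountable cardinal, $\lambda$ a singular (limit) cardinal with $\mathrm{cf}(\lambda)\geq\kappa$, and $\theta$ a cardinal with $2\leq\theta\leq\kappa$. Assume that the ideals named below exist, i.e. that for every cardinal $\tau$ with $\kappa\leq\tau\leq\lambda$ there is a $[\tau]^{<\theta}$-normal ideal on $P_\kappa(\tau)$. Suppose that for every cardinal $\tau$ with $\kappa\leq\tau<\lambda$, $\tau^{\mathrm{cf}(\lambda)}<\lambda$ and $\overline{\mathrm{cof}}(NS_{\kappa,\tau}^{[\tau]^{<\theta}})\leq\lambda^{<\overline\theta}$. Then the ideal $NS_{\kappa,\lambda}^{[\lambda]^{<\theta}}$ is nowhere precipitous.
   Context: Let $\sigma\geq\kappa$ be a cardinal. For a set $X$ and a cardinal $\rho$, $P_\rho(X)=\{a\subseteq X: |a|<\rho\}$, $P(X)$ is the power set of $X$, and $\sigma^{<\rho}=|P_\rho(\sigma)|$ for infinite $\sigma$ (so $\sigma^{<\rho}=\sigma$ if $2\leq\rho\leq\omega$). $I_{\kappa,\sigma}$ is the set of all $A\subseteq P_\kappa(\sigma)$ such that $\{a\in A: b\subseteq a\}=\emptyset$ for some $b\in P_\kappa(\sigma)$. An ideal on $P_\kappa(\sigma)$ is a collection $J$ of subsets of $P_\kappa(\sigma)$ such that $I_{\kappa,\sigma}\subseteq J$; $P_\kappa(\sigma)\notin J$; every subset of a member of $J$ is in $J$; and $\bigcup X\in J$ for every $X\in P_\kappa(J)$. Put $J^+=\{A\subseteq P_\kappa(\sigma):A\notin J\}$ and,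 for $A\in J^+$, $J\mid A=\{B\subseteq P_\kappa(\sigma): B\cap A\in J\}$. $\overline{\mathrm{cof}}(J)$ is the least size of any $Y\subseteq J$ such that for every $A\in J$ there is $y\in P_\kappa(Y)$ with $A\subseteq\bigcup y$. For cardinals $1\leq\mu\leq\sigma$ and $2\leq\theta\leq\kappa$, an ideal $J$ on $P_\kappa(\sigma)$ is $[\mu]^{<\theta}$-normal if for every $A\in J^+$ and every $f:A\to P_\theta(\mu)$ with $f(a)\in P_{|a\cap\theta|}(a\cap\mu)$ for all $a\in A$, there is $B\in J^+$, $B\subseteq A$, with $f$ constant on $B$. If there is such an ideal, $NS_{\kappa,\sigma}^{[\mu]^{<\theta}}$ denotes the smallest one. (For $\theta\leq\omega$ and $\mu=\sigma$ this is the nonstationary ideal on $P_\kappa(\sigma)$.) $\overline\theta=\theta$ if $\theta<\kappa$, or if $\theta=\kappa$ and $\kappa$ is a limit cardinal; $\overline\theta=\nu$ if $\theta=\kappa=\nu^+$. $\mathcal{M}_J$ is the collection of all $Q\subseteq J^+$ such that $A\cap B\in J$ for any distinct $A,B\in Q$, and for every $C\in J^+$ there is $A\in Q$ with $A\cap C\in J^+$. An ideal $J$ is precipitous if whenever $A\in J^+$ and $\langle Q_n:n<\omega\rangle$ is a sequence of members of $\mathcal{M}_{J\mid A}$ with $Q_{n+1}\subseteq\bigcup_{B\in Q_n}P(B)$ for all $n<\omega$, there is $f\in\prod_{n<\omega}Q_n$ such that $f(0)\supseteq f(1)\supseteq\cdots$ and $\bigcap_{n<\omega}f(n)\neq\emptyset$.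 $J$ is nowhere precipitous if for each $A\in J^+$, $J\mid A$ is not precipitous. *)

(* Defs.v *)
From mathcomp Require Import all_boot all_order.
From mathcomp Require Export all_classical.

Set Implicit Arguments.
Unset Strict Implicit.
Unset Printing Implicit Defensive.

Import Order.TTheory.

Local Open Scope classical_set_scope.
Local Open Scope card_scope.
Local Open Scope order_scope.

(* Ordinals are the elements of a totally ordered type T whose order is assumed
   to be a well-order; an ordinal a is identified, as in von Neumann's
   definition, with the set [seg a] of the smaller ordinals.  A statement about
   all ordinals up to l is a statement about every such T with an element l.
   Cardinals are initial ordinals.  The size of a set is not a value: sizes are
   compared with #<=, #= and #<, and the size of X is represented by X itself. *)

Definition card_lt (U V : Type) (A : set U) (B : set V) : bool :=
  (A #<= B) && (A #!= B).

Notation "A '#<' B" := (card_lt A B) (at level 79) : card_scope.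

(* $P_{|C|}(X)$ *)
Definition Psmall (U V : Type) (C : set U) (X : set V) : set (set V) :=
  [set a | a `<=` X /\ a #< C].

Section Ordinals.
Context {d : Order.disp_t} {T : orderType d}.
Implicit Types (a b c k l m n s t : T) (A B : set T).

Definition seg a : set T := [set x | x < a].

Definition least A : set T := A `&` lbound A.

Definition is_cardinal c : Prop := forall x, x < c -> seg x #< seg c.

Definition infinite_cardinal c : Prop := is_cardinal c /\ infinite_set (seg c).

Definition cofinal_in A l : Prop :=
  A `<=` seg l /\ forall x, x < l -> exists2 y, A y & x <= y.

(* The default value of [xget] is irrelevant, since [seg l] is cofinal in l. *)
Definition cof l : T :=
  xget l (least [set m | exists2 A, cofinal_in A l & A #= seg m]).

Definition regular_cardinal c : Prop := infinite_cardinal c /\ cof c = c.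

Definition singular_cardinal c : Prop := infinite_cardinal c /\ cof c < c.

Definition is_succ_cardinal n k : Prop :=
  is_cardinal n /\ least [set c | is_cardinal c /\ n < c] k.

(* $\overline\theta$, for t <= k; when t = k is a limit cardinal, there is no n
   to pick and [xget] returns its default value t. *)
Definition thetabar k t : T :=
  if t == k then xget t [set n | is_succ_cardinal n k] else t.

End Ordinals.

(* |X|^|E|, realized as the set of all functions from E to X. *)
Definition cexp (U V : Type) (X : set U) (E : set V) : set (E -> X) :=
  [set: E -> X].
Arguments cexp {U V} X E.

Section Ideals.
Context {d : Order.disp_t} {T : orderType d}.
Implicit Types (k s m t : T) (J : set (set (set T))) (A B C : set (set T)).

Definition Pks k s : set (set T) := Psmall (seg k) (seg s).

Definition bounded_ideal k s : set (set (set T)) :=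
  [set A | A `<=` Pks k s /\
    exists2 b, Pks k s b & [set a | A a /\ b `<=` a] = set0].

Definition is_ideal k s J : Prop :=
  [/\ (forall A, J A -> A `<=` Pks k s),
      bounded_ideal k s `<=` J,
      ~ J (Pks k s),
      (forall A B, J A -> B `<=` A -> J B)
    & (forall X, Psmall (seg k) J X -> J (\bigcup_(A in X) A))].

Definition positive k s J : set (set (set T)) :=
  [set A | A `<=` Pks k s /\ ~ J A].

Definition restrict_ideal k s J A : set (set (set T)) :=
  [set B | B `<=` Pks k s /\ J (B `&` A)].

Definition cofbar_base k J (Y : set (set (set T))) : Prop :=
  Y `<=` J /\
  forall A, J A -> exists2 y, Psmall (seg k) Y y & A `<=` \bigcup_(B in y) B.

(* A base of least size; it represents the cardinal $\overline{\mathrm{cof}}(J)$.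
   It exists for every ideal J by well-ordering of the cardinals. *)
Definition cofbar k J : set (set (set T)) :=
  xget J [set Y | cofbar_base k J Y /\
                  forall Z, cofbar_base k J Z -> Y #<= Z].

(* $[\mu]^{<\theta}$-normality, with mu = m and theta = t *)
Definition normal k s m t J : Prop :=
  forall A (f : set T -> set T), positive k s J A ->
    (forall a, A a -> Psmall (seg t) (seg m) (f a) /\
                      Psmall (a `&` seg t) (a `&` seg m) (f a)) ->
  exists B, [/\ positive k s J B, B `<=` A &
                exists c, forall a, B a -> f a = c].

Definition normal_ideal k s m t J : Prop :=
  is_ideal k s J /\ normal k s m t J.

(* $NS_{\kappa,\sigma}^{[\mu]^{<\theta}}$; see [NS_normal_ideal] and [NS_min]. *)
Definition NS k s m t : set (set (set T)) :=
  smallest (normal_ideal k s m t) set0.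

(* $\mathcal{M}_J$ *)
Definition max_antichain k s J (Q : set (set (set T))) : Prop :=
  [/\ Q `<=` positive k s J,
      (forall A B, Q A -> Q B -> A <> B -> J (A `&` B))
    & (forall C, positive k s J C ->
        exists2 A, Q A & positive k s J (A `&` C))].

Definition precipitous k s J : Prop :=
  forall A (Q : nat -> set (set (set T))), positive k s J A ->
    (forall n, max_antichain k s (restrict_ideal k s J A) (Q n)) ->
    (forall n, Q n.+1 `<=` \bigcup_(B in Q n) [set C | C `<=` B]) ->
  exists f : nat -> set (set T),
    [/\ (forall n, Q n (f n)), (forall n, f n.+1 `<=` f n)
      & \bigcap_n f n !=set0].

Definition nowhere_precipitous k s J : Prop :=
  forall A, positive k s J A -> ~ precipitous k s (restrict_ideal k s J A).

Lemma NS_min k s m t J : normal_ideal k s m t J -> NS k s m t `<=` J.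
Proof. by move=> HJ; exact: smallest_sub. Qed.

Lemma NS_normal_ideal k s m t :
  (exists J, normal_ideal k s m t J) -> normal_ideal k s m t (NS k s m t).
Proof.
move=> [J0 HJ0].
have posE A : positive k s (NS k s m t) A ->
    exists2 J, normal_ideal k s m t J & positive k s J A.
  move=> [AP nA]; apply: contrapT => H; apply: nA => J [HJ _].
  by apply: contrapT => nJA; apply: H; exists J.
split; first split.
- move=> A /(NS_min HJ0); case: HJ0 => -[H _ _ _ _] _; exact: H.
- by move=> A bA J [[[_ H _ _ _] _] _]; exact: H.
- by move/(NS_min HJ0); case: HJ0 => -[].
- move=> A B HA BA J [HJ _]; have [[_ _ _ H _] _] := HJ.
  exact: (H A B (NS_min HJ HA) BA).
- move=> X [XJ Xk] J [HJ _]; have [[_ _ _ _ H] _] := HJ.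
  by apply: H; split=> // A /XJ; exact: NS_min.
move=> A f /posE[J HJ JA] Hf.
have [_ nJ] := HJ; have [B [[BP nB] BA Bc]] := nJ A f JA Hf.
by exists B; split=> //; split=> // /(NS_min HJ).
Qed.

End Ideals.

(* Main.v *)
Require Import Defs.
From mathcomp Require Import all_boot all_order all_classical wochoice.
Import Order.TTheory.
Local Open Scope order_scope.
Local Open Scope classical_set_scope.
Local Open Scope card_scope.
Set Implicit Arguments.
Unset Strict Implicit.
Unset Printing Implicit Defensive.

(** Write mu for the cofinality of lambda, J_t for the smallest normal ideal on
    P_kappa(t), and J for J_lambda.  The hypothesis t^mu < lambda bounds, below
    lambda, every family of at most mu choices among fewer than lambda objects;
    hence lambda is a limit cardinal and P_kappa(lambda) has size lambda.

    Every null set of J is governed by one function from mu to lambda.  Let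
    tau_i (i < mu) be cardinals cofinal in lambda, all above mu.  The sets
    caught by a diagonal union over i in a of conditions a `&` tau_i in X_i,
    X_i in J_(tau_i), together with one fixed null set, already form a normal
    ideal ([NS_assembled_normal]): a witness that a is bad lies below some
    tau_m with m in a, because it is smaller than kappa <= mu, so it is seen by
    a `&` tau_m.  By minimality they are all of J.  Since cofbar(J_(tau_i)) is
    at most lambda, each J_(tau_i) has a cofinal family indexed by ordinals
    c < lambda, and by normality almost every a avoids, at i in a, the null set
    coded by c as soon as c is in a.  So there are a null set N and, for each A
    in J, a function h such that every a in A outside N has some i in a with
    h(i) not in a ([NS_representation]).

    Such an ideal lets the rank of points decrease ([tame_descent]).  A rank r
    on a positive set B is tame when its fibres, for a prescribed trace of a on
    mu, have size at most some fixed t < lambda.  A set a has fewer than kappa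
    elements, so it contains the graphs of boundedly many partial functions
    defined on its trace.  For each partial function g choose, if possible, a
    point of B capturing g whose rank exceeds the least rank sigma(g) of such
    points, and give it the new rank sigma(g).  The chosen points form a
    positive set: otherwise let h witness that they are null.  Then the points
    of B closed under h on their trace have their rank determined by their
    trace, so they are fewer than lambda, hence bounded; but they are positive.

    Iterating this along maximal antichains that refine each other, a point
    common to a branch would have an infinite descending sequence of ranks
    ([antichains_without_branch]). *)

(** * Comparison of sizes *)

Section Card.
Context {U V W : Type}.
Implicit Types (A : set U) (B : set V) (C : set W).

(** Relations spare the choice of a value for functions whose codomain is
    awkward to inhabit. *)
Lemma card_le_rel (R : U -> V -> Prop) A B :
  (forall x, A x -> exists2 y, B y & R x y) ->
  (forall x x' y, A x -> A x' -> R x y -> R x' y -> x = x') ->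
  A #<= B.
Proof.
move=> Rtot Rinj; apply/card_leP.
have sub (x : A) : exists y : B, R (val x) (val y).
  by have [y By Rxy] := Rtot _ (set_valP x); exists (exist _ y (mem_set By)).
have [f fR] := choice sub.
have finj : {in [set: A] &, injective f}.
  move=> x x' _ _ fxx'; apply: val_inj; apply: (Rinj _ _ (val (f x))) => //;
  [exact: set_valP|exact: set_valP|by rewrite fxx'].
by apply/injfunPex; exists f.
Qed.

Lemma card_le_inj (v0 : V) A B : A #<= B ->
  exists f : U -> V, (forall x, A x -> B (f x)) /\
    (forall x x', A x -> A x' -> f x = f x' -> x = x').
Proof.
move=> /card_leP[F].
pose f x := if pselect (A x) is left Ax
  then val (F (exist _ x (mem_set Ax))) else v0.
exists f; split=> [x Ax|x x' Ax Ax']; rewrite /f.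
  by case: pselect => // ?; exact: set_valP.
case: pselect => // {}Ax; case: pselect => // {}Ax' /val_inj.
by move=> /(@inj _ _ _ F _ _ (mem_set I) (mem_set I)) [].
Qed.

Lemma card_le_fun (f : U -> V) A B :
  (forall x, A x -> B (f x)) ->
  (forall x x', A x -> A x' -> f x = f x' -> x = x') -> A #<= B.
Proof.
move=> fAB finj; apply: (@card_le_rel (fun x y => y = f x)).
  by move=> x Ax; exists (f x) => //; exact: fAB.
by move=> x x' y Ax Ax' -> /finj; exact.
Qed.

Lemma card_lt_le_trans A B C : A #< B -> B #<= C -> A #< C.
Proof.
move=> /andP[AB nAB] BC; apply/andP; split; first exact: card_le_trans BC.
apply: contra nAB => AC; rewrite card_eq_le AB /=.
by apply: card_le_trans BC _; move: AC; rewrite card_eq_le => /andP[].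
Qed.

Lemma card_le_lt_trans A B C : A #<= B -> B #< C -> A #< C.
Proof.
move=> AB /andP[BC nBC]; apply/andP; split; first exact: card_le_trans BC.
apply: contra nBC => AC; rewrite card_eq_le BC /=.
by apply: card_le_trans AB; move: AC; rewrite card_eq_le => /andP[].
Qed.

Lemma card_ltNge A B : A #< B -> ~ (B #<= A).
Proof. by move=> /andP[AB nAB] BA; move: nAB; rewrite card_eq_le AB BA. Qed.

Lemma card_ltW A B : A #< B -> A #<= B.
Proof. by case/andP. Qed.

Lemma card_eqW A B : A #= B -> A #<= B.
Proof. by rewrite card_eq_le => /andP[]. Qed.

Lemma card_eqWr A B : A #= B -> B #<= A.
Proof. by rewrite card_eq_le => /andP[]. Qed.

Lemma finite_card_lt A B : finite_set A -> infinite_set B -> A #< B.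
Proof.
move=> Afin Binf; apply/andP; split.
  case: Afin => n; rewrite card_eq_le => /andP[An _].
  apply: card_le_trans An _; apply: card_le_trans (card_leT _) _.
  exact/infiniteP.
apply/negP => AB; apply: Binf; apply: card_le_finite Afin.
by move: AB; rewrite card_eq_le => /andP[].
Qed.

End Card.

Lemma card_le_bigcup (I V X Y : Type) (x0 : X) (y0 : Y) (D : set I)
    (F : I -> set V) (A : set X) (B : set Y) :
  D #<= A -> (forall i, D i -> F i #<= B) -> \bigcup_(i in D) F i #<= A `*` B.
Proof.
move=> DA FB; have [g [gA ginj]] := card_le_inj x0 DA.
have /choice[f fP] i : exists f : V -> Y, D i -> (forall v, F i v -> B (f v)) /\
    (forall v v', F i v -> F i v' -> f v = f v' -> v = v').
  have [Di|Di] := pselect (D i); last by exists (fun=> y0).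
  by have [f fP] := card_le_inj y0 (FB _ Di); exists f.
apply: (@card_le_rel _ _ (fun v xy => exists i,
  [/\ D i, F i v & xy = (g i, f i v)])).
  move=> v [i Di Fv]; exists (g i, f i v); last by exists i.
  by split; [exact: gA|exact: (fP i Di).1].
move=> v v' xy _ _ [i [Di Fv ->]] [i' [Di' Fv' [/ginj E]]].
by move: Fv'; rewrite -E// => Fv' /((fP i Di).2 _ _ Fv Fv').
Qed.

(** Well-foundedness in the form in which the well-order of the ordinals is
    given: a least element in each nonempty set. *)
Definition has_minima (W : Type) (lt : W -> W -> Prop) : Prop :=
  forall A : set W, A !=set0 -> exists2 x, A x & forall y, A y -> ~ lt y x.

Lemma has_minima_wf (W : Type) (lt : W -> W -> Prop) :
  has_minima lt -> well_founded lt.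
Proof.
move=> ltmin; apply: contrapT => /existsNP[x0 nx0].
have [x nx xmin] := ltmin [set x | ~ Acc lt x] (ex_intro _ x0 nx0).
apply: nx; constructor => y yx; apply: contrapT => ny; exact: (xmin y ny).
Qed.

(** By recursion along [lt], each element of [D] can be sent to a point of [S]
    not yet used, as long as the earlier elements are too few to exhaust [S]. *)
Lemma card_le_recursion (W V : Type) (lt : W -> W -> Prop)
    (D : set W) (S : set V) :
  has_minima lt ->
  (forall w w', D w -> D w' -> w <> w' -> lt w w' \/ lt w' w) ->
  (forall w, D w -> ~ (S #<= [set w' | D w' /\ lt w' w])) ->
  D #<= S.
Proof.
move=> ltmin lttot few.
have [->|/set0P[w0 Dw0]] := eqVneq D set0; first exact: card_ge0.
have [S0|/set0P[v0 _]] := eqVneq S set0.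
  by case: (few w0 Dw0); rewrite S0; exact: card_ge0.
have wf := has_minima_wf ltmin.
pose used w (g : forall w', lt w' w -> V) : set V :=
  [set v | exists w' (h : lt w' w), D w' /\ g w' h = v].
pose pick (X : set V) := if pselect (X !=set0) is left h
  then projT1 (cid h) else v0.
have pickP X : X !=set0 -> X (pick X).
  by rewrite /pick; case: pselect => // h _; case: (cid h).
pose next w g := pick (S `\` used w g).
pose F := Fix wf (fun=> V) next.
have FE w : F w = pick (S `\` F @` [set w' | D w' /\ lt w' w]).
  rewrite /F Fix_eq; last first.
    move=> x g g' gg'; congr next.
    by apply: functional_extensionality_dep => y;
      apply: functional_extensionality_dep => yx; exact: gg'.
  rewrite -/F /next; congr (pick (_ `\` _)); rewrite /used.
  apply/seteqP; split=> [v [w' [h [Dw' <-]]]|v [w' [Dw' h] <-]].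
    by exists w'.
  by exists w', h.
have FS w : D w -> (S `\` F @` [set w' | D w' /\ lt w' w]) (F w).
  move=> Dw; rewrite FE; apply: pickP; apply: contrapT => none.
  apply: (few w Dw); apply: card_le_trans (card_image_le F _).
  apply: subset_card_le => v Sv; apply: contrapT => nv.
  by apply: none; exists v.
apply: (@card_le_fun _ _ F) => [w /FS[]//|w w' Dw Dw' Fww'].
apply: contrapT => /(lttot _ _ Dw Dw')[lt_ww'|lt_w'w].
  by have [_] := FS _ Dw'; apply; exists w.
by have [_] := FS _ Dw; apply; exists w'.
Qed.

(** Negating the converse of a reflexive well-order makes it strict. *)
Lemma strict_well_order (W : Type) : exists lt : W -> W -> Prop,
  has_minima lt /\ forall w w', w <> w' -> lt w w' \/ lt w' w.
Proof.
have [R Rwo] := well_ordering_principle {classic W}.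
have Rmin (A : set W) : A !=set0 ->
    exists! w, A w /\ forall w', A w' -> R w w'.
  move=> [w0 Aw0]; have [w [[wmem wlb] wuniq]] :=
    Rwo (fun w => `[< A w >]) (ex_intro _ w0 (introT (asboolP _) Aw0)).
  exists w; split.
    by split=> [|w' Aw']; [exact/asboolP|exact/wlb/asboolP].
  move=> w' [Aw' w'lb]; apply: wuniq.
  by split=> [|v /asboolP]; [exact/asboolP|exact: w'lb].
exists (fun w' w => ~ R w w'); split=> [A /Rmin[w [[Aw wlb] _]]|w w' ww'].
  by exists w => // y /wlb Rwy; apply.
apply: contrapT => /not_orP[/contrapT Rw'w /contrapT Rww'].
have Rxx (x : W) : R x x.
  by have [y [[-> H] _]] := Rmin [set x] (ex_intro _ x erefl); exact: H.
have [z [_ zuniq]] := Rmin [set w; w'] (ex_intro _ w (or_introl erefl)).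
apply: ww'; transitivity z; first (apply/esym/zuniq; split; first by left).
  by move=> ? [] ->.
by apply/zuniq; split; [right|move=> ? [] ->].
Qed.

(** * Antichains along which ranks decrease *)

Section Descent.
Context {d : Order.disp_t} {T : orderType d}.
Context (k s : T) (K : set (set (set T))).
Hypothesis K_sub : forall A B, K A -> B `<=` A -> K B.
Hypothesis K_proper : ~ K (Pks k s).
Context (W : Type) (lt : W -> W -> Prop).
Hypothesis ltmin : has_minima lt.
Context (ranked : set (set T) -> (set T -> W) -> Prop).
Hypothesis ranked_sub : forall B B' r, B' `<=` B -> ranked B r -> ranked B' r.
Hypothesis ranked_start : exists r, ranked (Pks k s) r.
Hypothesis ranked_step : forall B r, positive k s K B -> ranked B r ->
  exists B' r', [/\ B' `<=` B, positive k s K B', ranked B' r' &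
    forall a, B' a -> lt (r' a) (r a)].
Implicit Types (A B C : set (set T)) (Q : set (set (set T))).
Implicit Types (rho : set (set T) -> set T -> W).

(** A maximal antichain inside a dense family is maximal among all positive
    sets: a positive set missed by it would contain a member of [D] to add. *)
Lemma max_antichain_dense (D : set (set (set T))) :
  D `<=` positive k s K ->
  (forall C, positive k s K C -> exists2 B, D B & B `<=` C) ->
  exists2 Q, Q `<=` D & max_antichain k s K Q.
Proof.
move=> DK Ddense.
pose anti Q := Q `<=` D /\ forall A B, Q A -> Q B -> A <> B -> K (A `&` B).
have [F Fanti Ftot|Q [[QD Qanti] Qmax]] := Zorn_bigcup (P := anti).
  split; first by move=> A [Q /Fanti[QD _]]; exact: QD.
  move=> A B [Q FQ QA] [Q' FQ' Q'B].
  have [QQ'|Q'Q] := Ftot _ _ FQ FQ'.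
    by apply: (Fanti _ FQ').2 => //; exact: QQ'.
  by apply: (Fanti _ FQ).2 => //; exact: Q'Q.
exists Q => //; split=> // [|C Cpos]; first exact: subset_trans DK.
apply: contrapT => nQ; have [B DB BC] := Ddense _ Cpos.
have [BP nKB] := DK _ DB.
have KB A : Q A -> K (A `&` B).
  move=> QA; apply: contrapT => nKAB; apply: nQ; exists A => //.
  split=> [a [_ /Cpos.1]//|KAC]; apply: nKAB; apply: K_sub KAC _ => a [Aa /BC].
  by split.
case: (Qmax (Q `|` [set B])); last split.
- split; first by move=> A QA; left.
  move=> /(_ B (or_intror erefl)) QB; apply: nKB; apply: K_sub (KB _ QB) _.
  by move=> a Ba; split.
- by move=> A [/QD//|->].
- move=> A A' [QA|->] [QA'|->] AA' //; [exact: Qanti|exact: KB|].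
  by rewrite setIC; exact: KB.
Qed.

(** The second component gives a rank to each member of the first; its values
    at other sets are irrelevant. *)
Definition stage : Type :=
  (set (set (set T)) * (set (set T) -> set T -> W))%type.

Definition ranked_antichain (st : stage) :=
  max_antichain k s K st.1 /\ forall B, st.1 B -> ranked B (st.2 B).

Definition descends (st st' : stage) :=
  (st'.1 `<=` \bigcup_(B in st.1) [set C | C `<=` B]) /\
  forall B B', st.1 B -> st'.1 B' -> B' `<=` B ->
    forall a, B' a -> lt (st'.2 B' a) (st.2 B a).

(** The sets given by [ranked_step] below members of the old antichain are
    dense.  Each new member lies below only one old member, since two old ones
    meet in a null set; so its rank can be compared with all of them. *)
Lemma ranked_antichain_descends st : ranked_antichain st ->
  exists2 st', ranked_antichain st' & descends st st'.
Proof.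
case: st => Q rho [[/= QK Qanti Qmax] Qr].
pose good B B' r' := [/\ B' `<=` B, ranked B' r' &
  forall a, B' a -> lt (r' a) (rho B a)].
have [||Q' Q'D Q'max] := max_antichain_dense
  (D := [set B' | positive k s K B' /\
                  exists2 B, Q B & exists r', good B B' r']).
- by move=> B' [].
- move=> C Cpos; have [A QA ACpos] := Qmax _ Cpos.
  have [||B' [r' [B'AC B'pos B'r' lt_r']]] := @ranked_step (A `&` C) (rho A).
  + exact: ACpos.
  + by apply: ranked_sub (Qr A QA) => a [].
  exists B'; last by move=> a /B'AC[].
  split=> //; exists A => //; exists r'; split=> //.
  by move=> a /B'AC[].
have /choice[rho' rho'P] B' : exists r', Q' B' -> exists2 B, Q B & good B B' r'.
  have [Q'B'|nQ'] := pselect (Q' B'); last by exists (rho B').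
  by have [_ [B QB [r' Br']]] := Q'D _ Q'B'; exists r' => _; exists B.
exists (Q', rho'); split=> //=.
- by move=> B' /rho'P[B _ []].
- by move=> B' /rho'P[B QB [B'B _ _]]; exists B.
move=> B B' QB Q'B' B'B a B'a; have [B1 QB1 [B'B1 _ lt_r']] := rho'P _ Q'B'.
suff -> : B = B1 by exact: lt_r'.
apply: contrapT => BB1; have [[_ nKB'] _] := Q'D _ Q'B'.
apply: nKB'; apply: K_sub (Qanti _ _ QB QB1 BB1) _ => b B'b.
by split; [exact: B'B|exact: B'B1].
Qed.

(** A point common to all sets of a branch would have ranks decreasing at each
    step. *)
Lemma antichains_without_branch : exists Q : nat -> set (set (set T)),
  [/\ forall n, max_antichain k s K (Q n),
      forall n, Q n.+1 `<=` \bigcup_(B in Q n) [set C | C `<=` B]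
    & forall f, (forall n, Q n (f n)) -> (forall n, f n.+1 `<=` f n) ->
        ~ (\bigcap_n f n !=set0)].
Proof.
have [r0 r0P] := ranked_start.
have st0P : ranked_antichain ([set Pks k s], fun=> r0).
  split=> [|B ->//]; split=> /= [A ->|A B -> -> //|C [CP nKC]].
    by split.
  exists (Pks k s) => //; split; first by move=> a [].
  by move=> KC; apply: nKC; apply: K_sub KC _ => a Ca; split; [exact: CP|].
have /choice[next nextP] st : exists st', ranked_antichain st ->
    ranked_antichain st' /\ descends st st'.
  have [/ranked_antichain_descends[st' ? ?]|?] := pselect (ranked_antichain st).
    by exists st'.
  by exists st.
pose st n := iter n next ([set Pks k s], fun=> r0).
have stP n : ranked_antichain (st n).
  by elim: n => [//|n IHn]; exact: (nextP _ IHn).1.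
exists (fun n => (st n).1); split=> [n|n|f Qf fdec [a fa]].
- exact: (stP n).1.
- exact: (nextP _ (stP n)).2.1.
pose w n := (st n).2 (f n) a.
have [_ [n _ <-] wmin] := ltmin (A := range w) (ex_intro _ (w 0%N)
  (ex_intro2 _ _ 0%N I erefl)).
apply: (wmin (w n.+1)); first by exists n.+1.
apply: (nextP _ (stP n)).2.2; [exact: Qf|exact: (Qf n.+1)|exact: fdec|].
exact: fa.
Qed.

End Descent.

(** * Ordinals and cofinality *)

Section Ordinals.
Context {d : Order.disp_t} {T : orderType d}.
Hypothesis Twf : well_order (<=%O : rel T).
Implicit Types (x z m c t l : T).

Lemma least_exists (A : set T) : A !=set0 -> exists x, least A x.
Proof.
move=> [x0 Ax0]; have [x [[Ax xlb] _]] :=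
  Twf (A := fun x => x \in A) (ex_intro _ x0 (mem_set Ax0)).
by exists x; split=> [|y Ay]; [exact: set_mem|exact: xlb (mem_set Ay)].
Qed.

Lemma lt_has_minima : has_minima (fun x y : T => x < y).
Proof.
move=> A /least_exists[x [Ax xlb]]; exists x => // y Ay.
by apply/negP; rewrite -leNgt; exact: xlb.
Qed.

Lemma seg_sub x y : x <= y -> seg x `<=` seg y.
Proof. by move=> xy z zx; exact: lt_le_trans xy. Qed.

Lemma seg_le x y : x <= y -> seg x #<= seg y.
Proof. by move=> /seg_sub; exact: subset_card_le. Qed.

(** The least ordinal that [X] injects into has the size of [X]: each of its
    proper initial segments is too small to exhaust [X], so it injects into [X]
    by recursion. *)
Lemma seg_is_cardinal (U : Type) (X : set U) t : X #<= seg t ->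
  exists m, [/\ m <= t, is_cardinal m & X #= seg m].
Proof.
move=> Xt; have [m [Xm mlb]] :=
  least_exists (A := [set m | X #<= seg m]) (ex_intro _ t Xt).
have nle w : w < m -> ~ (X #<= seg w).
  by move=> wm Xw; move: (mlb _ Xw); rewrite leNgt wm.
exists m; split; first exact: mlb.
  move=> w wm; apply/andP; split; first exact/seg_le/ltW.
  apply/negP => wm'; apply: (nle _ wm); apply: card_le_trans Xm _.
  by move: wm'; rewrite card_eq_le => /andP[].
rewrite card_eq_le Xm /=; apply: (card_le_recursion lt_has_minima).
  by move=> w w' _ _ /eqP; case: ltgtP => // _ _; [left|right].
move=> w wm; apply: contra_not (nle _ wm) => Xw.
by apply: card_le_trans Xw _; apply: subset_card_le => ? [].
Qed.

Lemma cardinal_lt (U : Type) (X : set U) l : X #< seg l ->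
  exists m, [/\ m < l, is_cardinal m & X #= seg m].
Proof.
move=> /andP[Xl nXl]; have [m [ml mc Xm]] := seg_is_cardinal Xl.
exists m; split=> //; rewrite lt_neqAle ml andbT.
by apply: contraNneq nXl => <-.
Qed.

Lemma cofP l : least [set m | exists2 A, cofinal_in A l & A #= seg m] (cof l).
Proof.
have [c cmem] := least_exists
  (A := [set m | exists2 A, cofinal_in A l & A #= seg m])
  (ex_intro _ l (ex_intro2 _ _ (seg l) (conj (@subset_refl _ _)
    (fun x xl => ex_intro2 _ _ x xl (lexx x))) (card_eqxx (seg l)))).
by apply: xgetPex; exists c.
Qed.

Lemma cofinal_card (X : set T) l : X `<=` seg l -> X #< seg (cof l) ->
  exists2 y, y < l & X `<=` seg y.
Proof.
move=> Xl Xcof; apply: contrapT => nX.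
have Xcofinal : cofinal_in X l.
  split=> // x xl; apply: contrapT => nx; apply: nX; exists x => // z Xz.
  by rewrite /seg /= ltNge; apply/negP => xz; apply: nx; exists z.
have [m [ml mc Xm]] := seg_is_cardinal (subset_card_le Xl).
have : cof l <= m by have [_] := cofP l; apply; exists X.
move=> /seg_le; apply: card_ltNge; apply: card_le_lt_trans Xcof.
by move: Xm; rewrite card_eq_le => /andP[].
Qed.

Lemma cofinal_fun l x0 : x0 < l -> exists g : T -> T,
  (forall i, g i < l) /\
  (forall x, x < l -> exists2 i, i < cof l & x <= g i).
Proof.
move=> x0l; have [[A [Al Acof] Am] _] := cofP l.
have [u [uA uinj]] := card_le_inj l (card_eqW Am).
exists (fun i => xget x0 [set x | A x /\ u x = i]).
split=> [i|x /Acof[y Ay xy]].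
  by case: xgetP => // x _ [/Al].
exists (u y); first exact: uA.
case: xgetP => [z _ [Az /uinj->]//|/(_ y) []]; last by [].
Qed.

End Ordinals.

(** * Normal ideals *)

Lemma thetabar_le {d : Order.disp_t} {T : orderType d} (k t : T) :
  t <= k -> thetabar k t <= k.
Proof.
rewrite /thetabar => tk; case: ifP => // _.
by case: xgetP => [n _ [_ [[_ /ltW]]]|].
Qed.

(** The default value [J] of [cofbar] is a base as well. *)
Lemma cofbar_is_base {d : Order.disp_t} {T : orderType d} (k s : T)
    (J : set (set (set T))) :
  infinite_set (seg k) -> is_ideal k s J -> cofbar_base k J (cofbar k J).
Proof.
move=> kinf Jideal; rewrite /cofbar; case: xgetP => [Y _ []//|_].
split=> // A JA; exists [set A]; last by move=> a Aa; exists A.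
by split=> [_ ->//|]; exact: finite_card_lt (finite_set1 A) kinf.
Qed.

Lemma seg_cutE {d : Order.disp_t} {T : orderType d} (a : set T) s t : s <= t ->
  a `&` seg t `&` seg s = a `&` seg s.
Proof.
by move=> st; rewrite -setIA; congr (_ `&` _); apply/setIidPr/seg_sub.
Qed.

Lemma Pks_cut {d : Order.disp_t} {T : orderType d} (k s t : T) a :
  Pks k s a -> Pks k t (a `&` seg t).
Proof.
move=> [_ ak]; split; first by move=> ? [].
by apply: card_le_lt_trans ak; apply: subset_card_le => ? [].
Qed.

Section SingularCardinal.
Context {d : Order.disp_t} {T : orderType d}.
Hypothesis Twf : well_order (<=%O : rel T).
Context (kappa lambda theta : T).
Local Notation mu := (cof lambda).
Hypothesis kappa_inf : infinite_set (seg kappa).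
Hypothesis theta_ge2 : `I_2 #<= seg theta.
Hypothesis theta_kappa : theta <= kappa.
Implicit Types (s t c m p q : T) (a b : set T) (A B : set (set T)).
Implicit Types (J : set (set (set T))).

(** The sets that a function tested by normality may select from [a]. *)
Definition admissible s a x : Prop :=
  Psmall (seg theta) (seg s) x /\ Psmall (a `&` seg theta) (a `&` seg s) x.

Section Fixed.
Context (s : T) (J : set (set (set T))).
Hypothesis Jideal : is_ideal kappa s J.

Lemma ideal_sub A B : J A -> B `<=` A -> J B.
Proof. by have [_ _ _ H _] := Jideal; exact: H. Qed.

Lemma ideal_setU A B : J A -> J B -> J (A `|` B).
Proof.
move=> JA JB; have [_ _ _ _ H] := Jideal.
apply: (@ideal_sub (\bigcup_(C in [set A; B]) C)); last first.
  by move=> a [Aa|Ba]; [exists A => //; left|exists B => //; right].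
apply: H; split; first by move=> _ [] ->.
exact: finite_card_lt (finite_set2 A B) kappa_inf.
Qed.

Lemma ideal_notin c : c < s -> J [set a | Pks kappa s a /\ ~ a c].
Proof.
move=> cs; have [_ H _ _ _] := Jideal; apply: H; split; first by move=> a [].
exists [set c]; last by apply/seteqP; split=> // a [[_ nac] /(_ c erefl)].
by split=> [_ ->//|]; exact: finite_card_lt (finite_set1 c) kappa_inf.
Qed.

End Fixed.

Lemma theta_two : exists p q, [/\ p < theta, q < theta & p <> q].
Proof.
have [f [ft finj]] := card_le_inj kappa theta_ge2.
exists (f 0%N), (f 1%N); split; [exact: (ft 0%N)|exact: (ft 1%N)|].
by move=> /(finj 0%N 1%N isT isT).
Qed.

Lemma card_set1_lt c (Y : set T) p q : Y p -> Y q -> p <> q -> [set c] #< Y.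
Proof.
move=> Yp Yq pq; apply/andP; split.
  by apply: (card_le_fun (f := fun=> p)) => // ? ? -> ->.
apply/negP => /card_eqWr/(card_le_inj c)[f [fc finj]]; apply: pq.
by apply: finj => //; rewrite (fc _ Yp) (fc _ Yq).
Qed.

Section Normal.
Context (s : T) (J : set (set (set T))).
Hypothesis kappa_s : kappa <= s.
Hypothesis Jnormal : normal_ideal kappa s s theta J.

(** Normality in its dual form: a diagonal union of null sets is null. *)
Lemma normal_diagonal (X : set T -> set (set T)) :
  (forall x, Psmall (seg theta) (seg s) x -> J (X x)) ->
  J [set a | Pks kappa s a /\ exists x, admissible s a x /\ X x a].
Proof.
move=> JX; set D := [set a | _]; have [Jideal Jn] := Jnormal.
apply: contrapT => nJD.
have /choice[f fP] a : exists x, D a -> admissible s a x /\ X x a.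
  have [[Pa [x xP]]|nDa] := pselect (D a); last by exists set0.
  by exists x.
have Dpos : positive kappa s J D by split=> // a [].
have [B [[BP nJB] BD [c Bc]]] := Jn D f Dpos (fun a Da => (fP a Da).1).
have [B0|/set0P[a Ba]] := eqVneq B set0.
  apply: nJB; rewrite B0; have [p [_ [pt _ _]]] := theta_two.
  apply: (ideal_sub Jideal) (ideal_notin Jideal _) _ => //.
  exact: lt_le_trans pt (le_trans theta_kappa kappa_s).
apply: nJB; apply: (ideal_sub Jideal (JX c _)).
  by rewrite -(Bc a Ba); case: (fP a (BD _ Ba)) => -[].
by move=> b Bb; rewrite -(Bc b Bb); case: (fP b (BD _ Bb)).
Qed.

(** The case of singletons; almost every [a] contains two ordinals below
    [theta], which makes its singletons admissible. *)
Lemma normal_diagonal1 (X : T -> set (set T)) :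
  (forall c, c < s -> J (X c)) ->
  J [set a | Pks kappa s a /\ exists2 c, a c & X c a].
Proof.
move=> JX; have [Jideal _] := Jnormal.
have [p [q [pt qt pq]]] := theta_two.
have ts : theta <= s by exact: le_trans kappa_s.
have Jpq := ideal_setU Jideal (ideal_notin Jideal (lt_le_trans pt ts))
  (ideal_notin Jideal (lt_le_trans qt ts)).
have Jdiag := @normal_diagonal
  (fun x => [set a | exists c, [/\ x = [set c], c < s & X c a]]).
apply: (ideal_sub Jideal (ideal_setU Jideal Jpq (Jdiag _))).
  move=> x _; have [[c [xc cs]]|nx] := pselect (exists c, x = [set c] /\ c < s).
    apply: (ideal_sub Jideal (JX c cs)) => a [c' [xc' _ Xa]].
    by have -> : c = c' by have : x c by [rewrite xc]; rewrite xc'.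
  apply: (ideal_sub Jideal Jpq) => a [c [xc cs _]].
  by case: nx; exists c.
move=> a [Pa [c ac Xa]].
have [ap|nap] := pselect (a p); last by left; left.
have [aq|naq] := pselect (a q); last by left; right.
have cs : c < s by exact: Pa.1.
right; split=> //; exists [set c]; split; last by exists c.
split; split; [by move=> _ ->|exact: (@card_set1_lt _ (seg theta) p q)
  |by move=> _ ->|].
by apply: (@card_set1_lt _ (a `&` seg theta) p q) pq.
Qed.

(** The sets whose preimage under [a |-> a `&` seg t] is null form a normal
    ideal, so they include the smallest one. *)
Lemma NS_lift t (X : set (set T)) : kappa <= t -> t <= s ->
  NS kappa t t theta X -> J [set a | Pks kappa s a /\ X (a `&` seg t)].
Proof.
move=> kt ts; have [Jideal Jn] := Jnormal.
pose lift (X : set (set T)) := [set a | Pks kappa s a /\ X (a `&` seg t)].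
pose K : set (set (set T)) := [set X | X `<=` Pks kappa t /\ J (lift X)].
suff KN : normal_ideal kappa t t theta K by move=> /(NS_min KN)[].
have Psub b : Pks kappa t b -> Pks kappa s b.
  by move=> [bt bk]; split=> //; apply: subset_trans bt _; exact: seg_sub.
have [J1 J2 J3 J4 J5] := Jideal.
split; first split.
- by move=> A [].
- move=> A [AP [b Pb Ab]]; split=> //; apply: J2; split; first by move=> a [].
  exists b; first exact: Psub.
  apply/seteqP; split=> // a [[Pa Xa] ba].
  have : [set a | A a /\ b `<=` a] (a `&` seg t).
    by split=> // c bc; split; [exact: ba|exact: Pb.1].
  by rewrite Ab.
- move=> [_ JP]; apply: J3; apply: J4 JP _ => a Pa; split=> //.
  exact: Pks_cut Pa.
- move=> A B [AP JA] BA; split; first exact: subset_trans AP.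
  by apply: J4 JA _ => a [Pa /BA].
- move=> Q [QK Qk]; split; first by move=> a [A /QK[AP _]]; exact: AP.
  have : J (\bigcup_(A in lift @` Q) A).
    apply: J5; split; first by move=> _ [A /QK[_ JA] <-].
    exact: card_le_lt_trans (card_image_le lift Q) Qk.
  move=> /J4; apply=> a [Pa [A QA Aa]].
  by exists (lift A) => //; exists A.
move=> A f [AP nKA] fA.
have Apos : positive kappa s J (lift A).
  by split=> [a []//|JA]; apply: nKA.
have tt : theta <= t by exact: le_trans kt.
have [|B [[BP nJB] BA [c Bc]]] := Jn _ (fun a => f (a `&` seg t)) Apos.
  move=> a [Pa /fA[[x1 x2] [x3]]]; rewrite seg_cutE // => x4; split; split=> //.
    by apply: subset_trans x1 _; exact: seg_sub.
  by move=> z /x3[[az _] /(seg_sub ts) zs].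
exists [set b | A b /\ f b = c]; split.
- split=> [b [/AP]//|[_ JB]]; apply: nJB; apply: J4 JB _ => a Ba.
  by have [Pa Aa] := BA _ Ba; split=> //; split=> //; exact: Bc.
- by move=> b [].
- by exists c => b [].
Qed.

End Normal.

(** * Cardinal arithmetic below lambda *)

Hypothesis kappa_mu : kappa <= mu.
Hypothesis mu_lambda : mu < lambda.
Hypothesis lambda_card : is_cardinal lambda.
Hypothesis kappa_card : is_cardinal kappa.
Hypothesis small_exp : forall tau : T, is_cardinal tau ->
  kappa <= tau < lambda -> cexp (seg tau) (seg mu) #< seg lambda.

Lemma mu_inf : infinite_set (seg mu).
Proof. exact: sub_infinite_set (seg_sub kappa_mu) kappa_inf. Qed.

Lemma card_lt_mu (U : Type) (X : set U) : X #< seg kappa -> X #< seg mu.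
Proof. by move=> /card_lt_le_trans; apply; exact: seg_le. Qed.

Lemma lambda_nomax x : x < lambda -> exists2 y, y < lambda & x < y.
Proof.
move=> xl; have [||y yl xy] := cofinal_card Twf (X := [set x]) (l := lambda).
- by move=> _ ->.
- exact: finite_card_lt (finite_set1 x) mu_inf.
by exists y => //; exact: xy.
Qed.

Lemma two_below x : infinite_set (seg x) ->
  exists p q, [/\ p < x, q < x & p <> q].
Proof.
move=> xinf; apply: contrapT => H.
have [p px] := infinite_setN0 xinf; apply: xinf.
apply: (@sub_finite_set _ _ [set p]); last exact: finite_set1.
by move=> q qx; apply: contrapT => qp; apply: H; exists q, p.
Qed.

(** Total functions replace functions between subtypes; outside the exponent
    they take the value [lambda], so that they are determined by their values
    there. *)
Lemma exp_lt t : is_cardinal t -> kappa <= t < lambda ->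
  [set g : T -> T | (forall i, i < mu -> g i < t) /\
                    (forall i, ~ i < mu -> g i = lambda)] #< seg lambda.
Proof.
move=> tcard tl; apply: card_le_lt_trans (small_exp tcard tl).
apply: (@card_le_rel _ _ (fun g phi =>
  forall i : seg mu, val (phi i : seg t) = g (val i))).
  move=> g [gt _]; exists (fun i : seg mu =>
    exist _ (g (val i)) (mem_set (gt _ (set_valP i)))) => //.
move=> g g' phi [_ gl] [_ gl'] Hg Hg'.
apply: functional_extensionality_dep => i.
have [imu|imu] := pselect (i < mu); last by rewrite gl ?gl'.
by rewrite -(Hg (exist _ i (mem_set imu))) (Hg' (exist _ i (mem_set imu))).
Qed.

(** A pair is a function on two of the ordinals below the cofinality. *)
Lemma prod_lt (U V : Type) (X : set U) (Y : set V) t : is_cardinal t ->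
  kappa <= t < lambda -> X #<= seg t -> Y #<= seg t -> X `*` Y #< seg lambda.
Proof.
move=> tcard tl Xt Yt; apply: card_le_lt_trans (exp_lt tcard tl).
have [p [q [pmu qmu pq]]] := two_below mu_inf.
have [f [ft finj]] := card_le_inj lambda Xt.
have [g [gt ginj]] := card_le_inj lambda Yt.
have qp : (q == p) = false by apply/eqP => qp; exact: pq.
have t0 : exists t0, t0 < t.
  have [z /= zk] := infinite_setN0 kappa_inf; exists z.
  by case/andP: tl => kt _; exact: lt_le_trans kt.
have [z zt] := t0.
apply: (@card_le_fun _ _ (fun uv i => if i < mu then
  if i == p then f uv.1 else if i == q then g uv.2 else z else lambda)).
  move=> [u v] [/= /ft fu /gt gv]; split=> i; last by move=> /negP/negbTE->.
  by move=> ->; case: ifP => // _; case: ifP.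
move=> [u v] [u' v'] [/= Xu Yv] [/= Xu' Yv'] E.
have := congr1 (fun h => h p) E; have := congr1 (fun h => h q) E => /=.
by rewrite pmu qmu eqxx qp eqxx => /(ginj _ _ Yv Yv')-> /(finj _ _ Xu Xu')->.
Qed.

(** Otherwise all ordinals below [lambda] would have at most one size [c], and
    [lambda], a union of [cof lambda] of them, would embed into a product that
    is smaller than [lambda]. *)
Lemma lambda_limit x : x < lambda ->
  exists t, [/\ is_cardinal t, x < t & t < lambda].
Proof.
move=> xl; apply: contrapT => none.
pose x' := Order.max x mu.
have x'l : x' < lambda by rewrite gt_max xl.
have mux' : mu <= x' by rewrite le_max lexx orbT.
have [c [cx' ccard x'c]] := seg_is_cardinal Twf (card_lexx (seg x')).
have cl : c < lambda by exact: le_lt_trans x'l.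
have kc : kappa <= c.
  rewrite leNgt; apply/negP => /kappa_card/card_ltNge; apply.
  apply: card_le_trans (seg_le (le_trans kappa_mu mux')) _; exact: card_eqW.
have seg_c y : y < lambda -> seg y #<= seg c.
  move=> yl; have [m [my mcard ym]] := seg_is_cardinal Twf (card_lexx (seg y)).
  apply: card_le_trans (card_eqW ym) _; apply: card_le_trans (card_eqW x'c).
  apply: seg_le; rewrite leNgt; apply/negP => x'm; apply: none; exists m.
  split=> //; last exact: le_lt_trans yl.
  by apply: le_lt_trans x'm; rewrite le_max lexx.
have [g [gl gcof]] := cofinal_fun Twf mu_lambda.
have /choice[f fP] i : exists f : T -> T, (forall z, z <= g i -> f z < c) /\
    (forall z z', z <= g i -> z' <= g i -> f z = f z' -> z = z').
  have [y yl giy] := lambda_nomax (gl i).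
  have [f [fc finj]] := card_le_inj lambda (seg_c _ yl).
  exists f; split=> [z zg|z z' zg zg'].
    by apply: fc; exact: le_lt_trans giy.
  by apply: finj; [exact: le_lt_trans zg giy|exact: le_lt_trans zg' giy].
have /card_ltNge : seg mu `*` seg c #< seg lambda.
  apply: (prod_lt ccard) (card_lexx _); first by rewrite kc.
  by apply: card_le_trans (card_eqW x'c); exact: seg_le.
apply.
apply: (@card_le_rel _ _ (fun z iw =>
  [/\ iw.1 < mu, z <= g iw.1 & f iw.1 z = iw.2])).
  move=> z /gcof[i imu zgi]; exists (i, f i z) => //; split=> //=.
  by apply: (fP i).1.
move=> z z' [i w] _ _ [/= _ zg <-] [_ zg' /esym]; exact: (fP i).2.
Qed.

(** For sets of size less than [lambda] ([smallP]), a bound to which the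
    hypothesis on exponentiation applies. *)
Definition small (U : Type) (X : set U) : Prop :=
  exists t, [/\ is_cardinal t, mu < t, t < lambda & X #<= seg t].

Section Small.
Context {U V : Type}.
Implicit Types (X : set U) (Y : set V).

Lemma small_card_lt X : X #< seg lambda -> small X.
Proof.
move=> /(cardinal_lt Twf)[m [ml _ Xm]].
have [|t [tcard mt tl]] := @lambda_limit (Order.max m mu).
  by rewrite gt_max ml.
exists t; move: mt; rewrite gt_max => /andP[mt mut]; split=> //.
by apply: card_le_trans (card_eqW Xm) _; exact/seg_le/ltW.
Qed.

Lemma smallP X : small X <-> X #< seg lambda.
Proof.
split=> [[t [_ _ tl Xt]]|]; last exact: small_card_lt.
by apply: card_le_lt_trans Xt _; exact: lambda_card.
Qed.

Lemma small_le X Y : X #<= Y -> small Y -> small X.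
Proof.
move=> XY [t [? ? ? Yt]]; exists t; split=> //; exact: card_le_trans Yt.
Qed.

End Small.

Lemma small_seg x : x < lambda -> small (seg x).
Proof. by move=> xl; apply: small_card_lt; exact: lambda_card. Qed.

Lemma small_setX (U V : Type) (X : set U) (Y : set V) :
  small X -> small Y -> small (X `*` Y).
Proof.
move=> [t [tc mut tl Xt]] [t' [tc' mut' tl' Yt']].
apply: small_card_lt; apply: (@prod_lt _ _ _ _ (Order.max t t')).
- by case: leP.
- by rewrite le_max gt_max tl tl' (le_trans kappa_mu (ltW mut)).
- by apply: card_le_trans Xt _; apply: seg_le; rewrite le_max lexx.
- by apply: card_le_trans Yt' _; apply: seg_le; rewrite le_max lexx orbT.
Qed.

Lemma small_bigcup (I V : Type) (D : set I) (F : I -> set V) t :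
  small D -> t < lambda -> (forall i, D i -> F i #<= seg t) ->
  small (\bigcup_(i in D) F i).
Proof.
move=> Ds tl Ft; apply: small_le (small_setX Ds (small_seg tl)).
have [->|/set0P[i0 Di0]] := eqVneq D set0.
  by rewrite bigcup_set0; exact: card_ge0.
exact: (card_le_bigcup i0 lambda (card_lexx D) Ft).
Qed.

(** A subset of size at most [cof lambda] is the range of a function. *)
Lemma small_powerset (U : Type) (X : set U) :
  small X -> small [set y | y `<=` X /\ y #<= seg mu].
Proof.
move=> [t0 [_ mut0 t0l Xt0]].
have [t [tc t0t tl]] := lambda_limit t0l.
apply: small_card_lt; have kt : kappa <= t < lambda.
  by rewrite tl (le_trans kappa_mu (ltW (lt_trans mut0 t0t))).
apply: card_le_lt_trans (exp_lt tc kt).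
have [f [ft finj]] := card_le_inj lambda Xt0.
apply: (@card_le_rel _ _ (fun (y : set U) (g : T -> T) =>
  forall u, X u -> y u <-> exists2 i, i < mu & g i = f u)).
  move=> y [yX ymu]; have [h [hmu hinj]] := card_le_inj lambda ymu.
  (* [t0] lies outside the range of [f], so it stands for no point of [X] *)
  pose P i : set T := [set w | exists u, [/\ y u, h u = i & f u = w]].
  pose g i := if i < mu then xget t0 (P i) else lambda.
  exists g.
    split=> i; last by rewrite /g => /negP/negbTE->.
    rewrite /g => ->; case: xgetP => // w _ [u [yu _ <-]].
    by apply: lt_trans t0t; exact/ft/yX.
  move=> u Xu; split=> [yu|[i imu]].
    exists (h u); first exact: hmu.
    rewrite /g (hmu _ yu : h u < mu).
    case: xgetP => [w _ [u' [yu' /hinj-> //]]|/(_ (f u)) []].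
    by exists u.
  rewrite /g imu; case: xgetP => [w _ [u' [yu' _ <-]]|_ E].
    by move=> /(finj _ _ (yX _ yu') Xu) <-.
  by have := ft _ Xu; rewrite /seg /= -E ltxx.
move=> y y' g [yX _] [yX' _] Hy Hy'; apply/seteqP; split=> u yu.
  by apply/Hy'; [exact: yX|apply/Hy => //; exact: yX].
by apply/Hy; [exact: yX'|apply/Hy' => //; exact: yX'].
Qed.

(** Well-order [D] by rank: every proper initial segment is then small, so a
    recursion of length at most [lambda] enumerates [D]. *)
Lemma card_le_ranked (W : Type) (D : set W) (rk : W -> T) :
  (forall w, D w -> rk w < lambda) ->
  (forall x, x < lambda -> small [set w | D w /\ rk w <= x]) ->
  D #<= seg lambda.
Proof.
move=> rkl levels; have [lt0 [lt0min lt0tot]] := strict_well_order W.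
pose lt w' w := rk w' < rk w \/ (rk w' = rk w /\ lt0 w' w).
apply: (@card_le_recursion _ _ lt).
- move=> A [w0 Aw0].
  have [x [[w1 Aw1 w1x] xlb]] := least_exists Twf (A := rk @` A)
    (ex_intro _ (rk w0) (ex_intro2 _ _ w0 Aw0 erefl)).
  have [w [Aw wx] wmin] := lt0min [set w | A w /\ rk w = x]
    (ex_intro _ w1 (conj Aw1 w1x)).
  exists w => // w' Aw' [|[w'w]]; last by apply: wmin; split=> //; rewrite w'w.
  by rewrite wx ltNge => /negP; apply; apply: xlb; exists w'.
- move=> w w' _ _ /lt0tot; rewrite /lt; case: (ltgtP (rk w) (rk w')) => [|_|E].
  + by left; left.
  + by right; left.
  + by rewrite E; case; [left|right]; right.
move=> w Dw; apply: card_ltNge.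
apply: card_le_lt_trans ((smallP _).1 (levels _ (rkl _ Dw))).
apply: subset_card_le => w' [Dw' []]; first by move=> /ltW.
by case=> E _; split=> //; rewrite E.
Qed.

(** Rank a set by a bound below [lambda], which exists because
    [kappa <= cof lambda]. *)
Lemma card_Pks : Pks kappa lambda #<= seg lambda.
Proof.
have /choice[rk rkP] (a : set T) : exists y, Pks kappa lambda a ->
    y < lambda /\ a `<=` seg y.
  have [[al ak]|na] := pselect (Pks kappa lambda a); last by exists lambda.
  by have [y yl ay] := cofinal_card Twf al (card_lt_mu ak); exists y.
apply: (@card_le_ranked _ _ rk) => [a /rkP[]//|x xl].
apply: small_le (small_powerset (small_seg xl)); apply: subset_card_le.
move=> a [Pa ax]; have [_ ak] := Pa; split; last exact/card_ltW/card_lt_mu.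
by apply: subset_trans (rkP _ Pa).2 _; exact: seg_sub.
Qed.

(** By transport along an injection of [D] into [seg lambda]. *)
Lemma card_Psmall (W : Type) (D : set W) :
  D #<= seg lambda -> Psmall (seg kappa) D #<= seg lambda.
Proof.
move=> Dl; apply: card_le_trans card_Pks.
have [f [fl finj]] := card_le_inj lambda Dl.
apply: (card_le_fun (f := fun y : set W => f @` y)).
  move=> y [yD yk]; split; first by move=> _ [w /yD/fl ? <-].
  exact: card_le_lt_trans (card_image_le f y) yk.
have sub y y' : y `<=` D -> y' `<=` D -> f @` y = f @` y' -> y `<=` y'.
  move=> yD yD' E w yw; have : (f @` y') (f w) by rewrite -E; exists w.
  by case=> w' yw' /(finj _ _ (yD' _ yw') (yD _ yw)) <-.
by move=> y y' [yD _] [yD' _] E; apply/seteqP; split; apply: sub.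
Qed.

(** * Decreasing the ranks of the points of a positive set *)

Section Step.
Context (J : set (set (set T))) (N : set (set T)).
Hypothesis Jnormal : normal_ideal kappa lambda lambda theta J.
Hypothesis JN : J N.
Hypothesis J_representation : forall A, J A -> exists h : T -> T,
  (forall i, h i < lambda) /\
  forall a, A a -> ~ N a -> exists i, [/\ i < mu, a i & ~ a (h i)].

Let Jideal := Jnormal.1.

(** Fewer than [lambda] sets of size less than [kappa] leave some ordinal below
    [lambda] uncovered. *)
Lemma small_null B : B `<=` Pks kappa lambda -> small B -> J B.
Proof.
move=> BP Bs; have kl := le_lt_trans kappa_mu mu_lambda.
have : small (\bigcup_(a in B) a).
  apply: (small_bigcup Bs kl).
  by move=> a /BP[_]; exact: card_ltW.
move=> /smallP/card_ltNge nle.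
have [c cl nc] : exists2 c, c < lambda & forall a, B a -> ~ a c.
  apply: contrapT => nc; apply: nle; apply: subset_card_le => c cl.
  apply: contrapT => nB; apply: nc; exists c => // a Ba ac; apply: nB.
  by exists a.
apply: (ideal_sub Jideal (ideal_notin Jideal cl)) => a Ba.
by split; [exact: BP|exact: nc].
Qed.

(** The restriction of [h] to the trace of [a] on [cof lambda], as a set of
    pairs, so that restrictions to equal traces are equal. *)
Definition graph_on h a : set (T * T) :=
  [set ij | [/\ ij.1 < mu, a ij.1 & ij.2 = h ij.1]].

Definition captures a g : Prop :=
  exists2 h, g = graph_on h a & forall i, i < mu -> a i -> a (h i).

(** The domain of a captured partial function is the trace of the capturing
    set. *)
Lemma capturesP h a a' : captures a' (graph_on h a) ->
  a `&` seg mu = a' `&` seg mu /\ forall i, i < mu -> a' i -> a' (h i).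
Proof.
move=> [h' E Hh'].
have E1 i : i < mu -> a i -> a' i /\ h i = h' i.
  move=> imu ai; have : graph_on h a (i, h i) by [].
  by rewrite E => -[].
have E2 i : i < mu -> a' i -> a i /\ h i = h' i.
  move=> imu ai; have : graph_on h' a' (i, h' i) by [].
  by rewrite -E => -[/= _ ? ->].
split; last by move=> i imu /[dup] a'i /E2[]// _ ->; exact: Hh'.
by apply/seteqP; split=> i [ai imu]; split=> //;
  [case: (E1 i imu ai)|case: (E2 i imu ai)].
Qed.

Lemma graph_on_cut h a : graph_on h (a `&` seg mu) = graph_on h a.
Proof.
by apply/seteqP; split=> -[i j] [/= imu]; [case=> ai _|move=> ai]; split.
Qed.

Definition captured a : set (set (T * T)) := [set g | captures a g].

(** A partial function captured by [a] is a subset of [a `*` a], and [a] has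
    fewer than [kappa] elements; [t] bounds the number of such subsets. *)
Lemma few_captured : exists2 t, t < lambda &
  forall a, Pks kappa lambda a -> captured a #<= seg t.
Proof.
have ks := small_seg (le_lt_trans kappa_mu mu_lambda).
have [t [_ _ tl Mt]] := small_powerset (small_setX ks ks).
exists t => // a [al ak]; apply: card_le_trans Mt.
have [f [fk finj]] := card_le_inj kappa (card_ltW ak).
pose ff (ij : T * T) := (f ij.1, f ij.2).
have sub g : captures a g -> g `<=` a `*` a.
  by move=> [h -> ha] [i j] [/= imu ai ->]; split=> //; exact: ha.
have ffinj g g' : captures a g -> captures a g' ->
    ff @` g = ff @` g' -> g `<=` g'.
  move=> /sub ga /sub g'a E [i j] gij.
  have : (ff @` g') (ff (i, j)) by rewrite -E; exists (i, j).
  case=> -[i' j'] g'ij [fi fj].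
  have <- : i' = i := finj _ _ (g'a _ g'ij).1 (ga _ gij).1 fi.
  by have <- : j' = j := finj _ _ (g'a _ g'ij).2 (ga _ gij).2 fj.
apply: (card_le_fun (f := fun g => ff @` g)).
  move=> g cg; split.
    move=> _ [[i j] /(sub _ cg)[/= ai aj] <-].
    by split; exact: fk.
  apply: card_le_trans (card_image_le _ _) _.
  have [h -> _] := cg; apply: card_le_trans (seg_le kappa_mu).
  apply: card_le_trans (card_ltW ak).
  apply: (card_le_fun (f := fst)) => [[i j] [] //|[i j] [i' j']].
  by move=> [_ _ /= ->] [_ _ /= ->] /= ->.
by move=> g g' cg cg' E; apply/seteqP; split; apply: ffinj.
Qed.

Section Rank.
Context (W : Type) (lt : W -> W -> Prop).
Hypothesis ltmin : has_minima lt.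
Hypothesis lttot : forall w w', w <> w' -> lt w w' \/ lt w' w.

Definition fibre B (r : set T -> W) (x : set T) w : set (set T) :=
  [set a | [/\ B a, a `&` seg mu = x & r a = w]].

(** There are fewer than [lambda] traces, so the points whose rank is a given
    function of their trace are fewer than [lambda]: too few to be positive. *)
Definition tame B (r : set T -> W) : Prop :=
  B `<=` Pks kappa lambda /\
  exists2 t, t < lambda & forall x w, fibre B r x w #<= seg t.

Lemma tame_sub B B' r : B' `<=` B -> tame B r -> tame B' r.
Proof.
move=> B'B [BP [t tl Bt]]; split; first exact: subset_trans BP.
exists t => // x w; apply: card_le_trans (Bt x w); apply: subset_card_le.
by move=> a [/B'B].
Qed.

Lemma tame_injective r : (forall a b, r a = r b -> a = b) ->
  tame (Pks kappa lambda) r.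
Proof.
move=> rinj; split=> //; exists kappa; first exact: le_lt_trans mu_lambda.
move=> x w; have [->|/set0P[a [_ _ <-]]] :=
    eqVneq (fibre (Pks kappa lambda) r x w) set0.
  exact: card_ge0.
apply: card_le_trans (card_ltW (finite_card_lt (finite_set1 a) kappa_inf)).
by apply: subset_card_le => b [_ _ /rinj].
Qed.

(** [sigma g] is the least rank of a point capturing [g], and [pt g] a point of
    larger rank, if there is one; the new set consists of these points, and the
    new rank of [pt g] is [sigma g].  Fibres stay bounded because a fibre of the
    new rank injects into the partial functions captured by the points of one
    fibre of the old rank. *)
Lemma tame_descent B r : positive kappa lambda J B -> tame B r ->
  exists B' r', [/\ B' `<=` B, positive kappa lambda J B', tame B' r' &
    forall a, B' a -> lt (r' a) (r a)].
Proof.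
move=> [BP nJB] [_ [t tl Bt]].
pose cand g a := [/\ B a, ~ N a & captures a g].
have /choice[sigma sigmaP] g : exists w, (exists a, cand g a) ->
    (exists2 a, cand g a & r a = w) /\ forall a, cand g a -> ~ lt (r a) w.
  have [[a ca]|nc] := pselect (exists a, cand g a); last by exists (r set0).
  have [w [a' ca' <-] wmin] := ltmin (A := r @` cand g)
    (ex_intro _ (r a) (ex_intro2 _ _ a ca erefl)).
  exists (r a') => _; split; first by exists a'.
  by move=> b cb; apply: wmin; exists b.
pose G g := exists a, cand g a /\ r a <> sigma g.
have /choice[pt ptP] g : exists a, G g -> cand g a /\ lt (sigma g) (r a).
  have [[a [ca ra]]|nG] := pselect (G g); last by exists set0.
  exists a => _; split=> //; have [|//] := lttot ra.
  by move=> rag; case: ((sigmaP g (ex_intro _ a ca)).2 a ca).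
have /choice[src srcP] a : exists g, (pt @` G) a -> G g /\ pt g = a.
  have [[g Gg ga]|na] := pselect ((pt @` G) a); last by exists set0.
  by exists g.
pose B' := pt @` G; pose r' a := sigma (src a).
have B'B a : B' a -> B a by move=> [g /ptP[[]] Bg _ _ _ <-].
exists B', r'; split=> //; last first.
- by move=> a /srcP[Gg ga]; rewrite -{2}ga; exact: (ptP _ Gg).2.
- split; first by move=> a /B'B/BP.
  have [t0 t0l ct0] := few_captured.
  have [t1 [_ _ t1l tt0]] := small_setX (small_seg tl) (small_seg t0l).
  exists t1 => // x w; apply: card_le_trans tt0.
  apply: card_le_trans (card_le_bigcup lambda lambda (Bt x w)
    (F := captured) _); last first.
    by move=> b [Bb _ _]; exact/ct0/BP.
  apply: (card_le_fun (f := src)) =>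
      [a [B'a ax rw]|a a' [B'a _ _] [B'a' _ _] E].
    have [Gg ga] := srcP a B'a; have [b0 [cb0 _]] := Gg.
    have [[b [Bb nNb cb] rb] _] := sigmaP _ (ex_intro _ b0 cb0).
    exists b => //; split=> //; last by rewrite rb.
    have [[_ _ ca] _] := ptP _ Gg; rewrite ga in ca.
    by have [h gE _] := ca; rewrite gE in cb; have [<- _] := capturesP cb.
  by have [_ <-] := srcP a B'a; have [_ <-] := srcP a' B'a'; rewrite E.
split=> [a /B'B/BP//|JB'].
(* Every chosen point violates [h]; so for a point of [B1] the restriction of
   [h] to its trace had no chosen point, and [sigma] is the rank of all points
   of [B] that capture it. *)
have [h [hl hP]] := J_representation JB'.
pose B1 := [set a | [/\ B a, ~ N a & forall i, i < mu -> a i -> a (h i)]].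
have Jesc : J [set a | Pks kappa lambda a /\
    exists2 i, a i & (Pks kappa lambda a /\ ~ a (h i))].
  apply: (normal_diagonal1 _ Jnormal
    (X := fun i => [set a | Pks kappa lambda a /\ ~ a (h i)])).
    exact/ltW/(le_lt_trans kappa_mu).
  by move=> i _; exact: ideal_notin.
suff JB1 : J B1.
  apply: nJB; apply: (ideal_sub Jideal
    (ideal_setU Jideal (ideal_setU Jideal JN Jesc) JB1)) => a Ba.
  have [Na|nNa] := pselect (N a); first by left; left.
  have [ha|/existsNP[i]] := pselect (forall i, i < mu -> a i -> a (h i)).
    by right.
  move=> /not_implyP[imu /not_implyP[ai nahi]]; left; right.
  by split; [exact: BP|exists i => //; split=> //; exact: BP].
have B1F : B1 `<=`
    \bigcup_(x in [set x | x `<=` seg mu /\ x #<= seg mu])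
      fibre B r x (sigma (graph_on h x)).
  move=> a [Ba nNa ha]; exists (a `&` seg mu).
    by split; [move=> ? []|apply: subset_card_le => ? []].
  split=> //; rewrite graph_on_cut; apply: contrapT => ra.
  have ca : cand (graph_on h a) a by split=> //; exists h.
  have Gg : G (graph_on h a) by exists a.
  have [[_ nNp cp] _] := ptP _ Gg.
  have [_ hp] := capturesP cp.
  have [|i [imu pi]] := hP (pt (graph_on h a)) _ nNp.
    by exists (graph_on h a).
  by apply; exact: hp.
apply: small_null; first by move=> a [/BP].
apply: small_le (subset_card_le B1F) _.
by apply: small_bigcup (small_powerset (small_seg mu_lambda)) tl _ => x _.
Qed.

End Rank.
End Step.

(** * The null sets of the smallest normal ideal *)

Hypothesis NS_exist : forall t : T, is_cardinal t -> kappa <= t <= lambda ->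
  exists J, normal_ideal kappa t t theta J.
Hypothesis small_cof : forall t : T, is_cardinal t -> kappa <= t < lambda ->
  cofbar kappa (NS kappa t t theta)
    #<= Psmall (seg (thetabar kappa theta)) (seg lambda).

Section Decomposition.
Context (tau : T -> T).
Hypothesis tau_card : forall i, is_cardinal (tau i).
Hypothesis mu_tau : forall i, mu < tau i.
Hypothesis tau_lambda : forall i, tau i < lambda.
Hypothesis tau_cofinal : forall y, y < lambda -> exists2 i, i < mu & y <= tau i.

Local Notation NSt i := (NS kappa (tau i) (tau i) theta).
Local Notation NSl := (NS kappa lambda lambda theta).

Let kappa_tau i : kappa <= tau i.
Proof. exact: le_trans kappa_mu (ltW (mu_tau i)). Qed.

Let kappa_lambda : kappa <= lambda.
Proof. exact: le_trans kappa_mu (ltW mu_lambda). Qed.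

Let NSt_normal i : normal_ideal kappa (tau i) (tau i) theta (NSt i).
Proof.
by apply: NS_normal_ideal; apply: NS_exist => //; rewrite kappa_tau ltW.
Qed.

Let NSl_normal : normal_ideal kappa lambda lambda theta NSl.
Proof.
by apply: NS_normal_ideal; apply: NS_exist => //; rewrite kappa_lambda lexx.
Qed.

Let NSt_ideal i := (NSt_normal i).1.
Let NSl_ideal := NSl_normal.1.

(** Holds of almost every [a] ([unguarded_null]); it lets the traces
    [a `&` seg (tau i)], for [i] in [a], see all that normality may select from
    [a]. *)
Definition guarded a : Prop :=
  (exists2 i, i < mu & a i) /\
  forall x, admissible lambda a x ->
    exists i, [/\ i < mu, a i & x `<=` seg (tau i)].

Definition caught X a : Prop :=
  exists i, [/\ i < mu, a i & X i (a `&` seg (tau i))].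

Lemma bounded_in x : x `<=` seg lambda -> x #< seg kappa ->
  exists2 i, i < mu & x `<=` seg (tau i).
Proof.
move=> xl xk; have [y yl xy] := cofinal_card Twf xl (card_lt_mu xk).
have [i imu yi] := tau_cofinal yl; exists i => //.
by apply: subset_trans xy _; exact: seg_sub.
Qed.

Lemma mu_inhabited : exists i, i < mu.
Proof.
have [i ik] := infinite_setN0 kappa_inf; exists i.
exact: lt_le_trans kappa_mu.
Qed.

(** By normality it suffices to treat a single selected set; being smaller than
    [kappa], it lies below one [tau i], and almost every [a] contains [i]. *)
Lemma unguarded_null : NSl [set a | Pks kappa lambda a /\ ~ guarded a].
Proof.
have [i0 i0mu] := mu_inhabited.
have Ni0 := ideal_notin NSl_ideal (lt_trans i0mu mu_lambda).
have := normal_diagonal kappa_lambda NSl_normal (X := fun x =>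
  [set a | Pks kappa lambda a /\
           forall i, i < mu -> a i -> ~ (x `<=` seg (tau i))]).
move=> /(_ _)/(ideal_setU NSl_ideal Ni0) N; apply: (ideal_sub NSl_ideal (N _)).
  move=> x [xl xt]; have [|i imu xi] := bounded_in xl.
    by apply: card_lt_le_trans xt _; exact: seg_le.
  apply: (ideal_sub NSl_ideal
    (ideal_notin NSl_ideal (lt_trans imu mu_lambda))).
  by move=> a [Pa H]; split=> // ai; exact: H ai xi.
move=> a [Pa nga]; have [ai0|?] := pselect (a i0); last by left.
right; split=> //; apply: contrapT => nx; apply: nga; split; first by exists i0.
move=> x ax; apply: contrapT => ni; apply: nx; exists x; split=> //; split=> //.
by move=> i imu ai xi; apply: ni; exists i.
Qed.

Lemma caught_null X : (forall i, i < mu -> NSt i (X i)) ->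
  NSl [set a | Pks kappa lambda a /\ caught X a].
Proof.
move=> NX.
have N := normal_diagonal1 kappa_lambda NSl_normal (X := fun i =>
  [set a | Pks kappa lambda a /\ (i < mu /\ X i (a `&` seg (tau i)))]).
apply: (ideal_sub NSl_ideal (N _)); last first.
  by move=> a [Pa [i [imu ai Xi]]]; split=> //; exists i.
move=> i _; have [imu|nimu] := pselect (i < mu); last first.
  have [i0 i0mu] := mu_inhabited.
  apply: (ideal_sub NSl_ideal
    (ideal_notin NSl_ideal (lt_trans i0mu mu_lambda))).
  by move=> a [_ []].
apply: (ideal_sub NSl_ideal (NS_lift
  NSl_normal (kappa_tau i) (ltW (tau_lambda i)) (NX i imu))).
by move=> a [Pa []].
Qed.

Definition NS_assembled : set (set (set T)) :=
  [set A | A `<=` Pks kappa lambda /\ exists2 X,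
    (forall i, i < mu -> NSt i (X i)) &
    forall a, A a -> guarded a -> caught X a].

Lemma NS_assembled_sub : NS_assembled `<=` NSl.
Proof.
move=> A [AP [X NX AX]].
apply: (ideal_sub NSl_ideal
  (ideal_setU NSl_ideal unguarded_null (caught_null NX))).
move=> a Aa; have [ga|nga] := pselect (guarded a); last first.
  by left; split=> //; exact: AP.
by right; split; [exact: AP|exact: AX].
Qed.

(** A set [b] with fewer than [kappa] elements lies below some [tau j], so that
    [b] not being included in [a] is seen at [j] if [a] contains [j]; otherwise
    the absence of [j], which is below every [tau i], is seen at any [i] in
    [a]. *)
Lemma NS_assembled_ideal : is_ideal kappa lambda NS_assembled.
Proof.
split.
- by move=> A [].
- move=> A [AP [b [bl bk] Ab]]; split=> //.
  have [j jmu bj] := bounded_in bl bk.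
  exists (fun i => [set c | Pks kappa (tau i) c /\ ~ c j] `|`
    [set c | Pks kappa (tau i) c /\ ~ (b `&` seg (tau i) `<=` c)]).
    move=> i imu; apply: (ideal_setU (NSt_ideal i)).
      exact: (ideal_notin (NSt_ideal i) (lt_trans jmu (mu_tau i))).
    have [_ H _ _ _] := NSt_ideal i; apply: H; split; first by move=> ? [].
    exists (b `&` seg (tau i)); first exact: Pks_cut (conj bl bk).
    by apply/seteqP; split=> // c [[_ nbc] /nbc].
  move=> a Aa [[i imu ai] _]; have Pa := AP _ Aa.
  have [aj|naj] := pselect (a j); last first.
    by exists i; split=> //; left; split; [exact: Pks_cut Pa|case].
  exists j; split=> //; right; split; first exact: Pks_cut Pa.
  move=> ba; have : [set a | A a /\ b `<=` a] a.
    by split=> // c bc; apply: (proj1 (ba c _)); split=> //; exact: bj.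
  by rewrite Ab.
- move=> /NS_assembled_sub; have [_ _ H _ _] := NSl_ideal; exact: H.
- move=> A B [AP [X NX AX]] BA; split; first exact: subset_trans AP.
  by exists X => // a /BA; exact: AX.
move=> Q [QK Qk]; split; first by move=> a [A /QK[AP _]]; exact: AP.
have /choice[X XP] A : exists X, Q A -> (forall i, i < mu -> NSt i (X i)) /\
    forall a, A a -> guarded a -> caught X a.
  have [QA|nQA] := pselect (Q A); last by exists (fun=> set0).
  by have [_ [X NX AX]] := QK _ QA; exists X.
exists (fun i => \bigcup_(A in Q) X A i).
  move=> i imu; have [_ _ _ _ H] := NSt_ideal i.
  have := H ((fun A => X A i) @` Q); rewrite bigcup_image; apply.
  split; first by move=> _ [A QA <-]; exact: (XP A QA).1.
  exact: card_le_lt_trans (card_image_le _ _) Qk.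
move=> a [A QA Aa] ga; have [i [imu ai Xi]] := (XP A QA).2 a Aa ga.
by exists i; split=> //; exists A.
Qed.

(** Suppose that each set [f a = x] is caught by a family [X x].  If [a] is
    guarded, then [f a] lies below [tau i] and [a] is caught by [X (f a)] at
    [k], with [i] and [k] in [a].  All of this is seen by [a `&` seg (tau m)],
    where [m] is whichever of [i] and [k] has the larger [tau]: so [a] is caught
    at [m] by a diagonal union of null sets, over [x] and over [k]. *)
Lemma NS_assembled_normal : normal_ideal kappa lambda lambda theta NS_assembled.
Proof.
split; first exact: NS_assembled_ideal.
move=> A f [AP nKA] fA; apply: contrapT => nB; apply: nKA; split=> //.
have /choice[X XP] x : exists X, (forall i, i < mu -> NSt i (X i)) /\
    forall a, A a -> f a = x -> guarded a -> caught X a.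
  apply: contrapT => nX; apply: nB; exists [set a | A a /\ f a = x].
  split; [split|by move=> a []|by exists x => a []].
    by move=> a [/AP].
  by move=> [_ [X NX AX]]; apply: nX; exists X; split=> // a Aa fa; exact: AX.
have theta_tau i : theta <= tau i by exact: le_trans (kappa_tau i).
pose Z i x k := [set b | Pks kappa (tau i) b /\
  ([/\ k < mu, tau k <= tau i & X x k (b `&` seg (tau k))])].
exists (fun i => [set b | Pks kappa (tau i) b /\ exists x,
    admissible (tau i) b x /\
    (Pks kappa (tau i) b /\ exists2 k, b k & Z i x k b)]).
  move=> i imu.
  apply: (normal_diagonal (kappa_tau i) (NSt_normal i)
    (X := fun x => [set b | Pks kappa (tau i) b /\
                            exists2 k, b k & Z i x k b])).
  move=> x _.
  apply: (normal_diagonal1 (kappa_tau i) (NSt_normal i) (X := Z i x)).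
  move=> k _.
  have [[kmu ki]|nk] := pselect (k < mu /\ tau k <= tau i); last first.
    apply: (ideal_sub (NSt_ideal i)
      (ideal_notin (NSt_ideal i) (lt_trans imu (mu_tau i)))).
    by move=> b [_ [kmu ki _]]; case: nk.
  apply: (ideal_sub (NSt_ideal i)
    (NS_lift (NSt_normal i) (kappa_tau k) ki ((XP x).1 k kmu))).
  by move=> b [Pb [_ _]].
move=> a Aa ga; have [[x1 x2] [x3 x4]] := fA a Aa.
have [i [imu ai xi]] := ga.2 _ (fA a Aa).
have [k [kmu ak Xk]] := (XP (f a)).2 a Aa erefl ga.
have Pa := AP _ Aa.
suff [m [mmu am im km]] :
    exists m, [/\ m < mu, a m, tau i <= tau m & tau k <= tau m].
  exists m; split=> //; split; first exact: Pks_cut Pa.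
  exists (f a); split; last split; [|exact: Pks_cut Pa|].
    split; split=> //.
    - by apply: subset_trans xi _; exact: seg_sub.
    - rewrite seg_cutE // => y fy; split; first by case: (x3 y fy).
      by apply: seg_sub im _ _; exact: xi.
    - by rewrite seg_cutE.
  exists k; first by split=> //; exact: lt_trans kmu (mu_tau m).
  by split; [exact: Pks_cut Pa|split=> //; rewrite seg_cutE].
have [ik|/ltW ki] := leP (tau i) (tau k); first by exists k.
by exists i.
Qed.

Lemma NS_assembledE : NSl = NS_assembled.
Proof.
apply/seteqP; split; last exact: NS_assembled_sub.
exact: NS_min NS_assembled_normal.
Qed.

(** The unions of fewer than [kappa] members of a base of size at most [lambda]
    are cofinal in the ideal, and there are at most [lambda] of them. *)
Lemma NSt_enumeration i : exists Z : T -> set (set T),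
  (forall c, NSt i (Z c)) /\
  (forall A, NSt i A -> exists2 c, c < lambda & A `<=` Z c).
Proof.
have [YJ Ycov] := cofbar_is_base kappa_inf (NSt_ideal i).
have [|u [ul uinj]] := @card_le_inj _ _ lambda
    (Psmall (seg kappa) (cofbar kappa (NSt i))) (seg lambda).
  apply: card_Psmall => //; apply: card_le_trans (small_cof _ _) _ => //.
    by rewrite kappa_tau tau_lambda.
  apply: card_le_trans card_Pks.
  apply: subset_card_le => x [xl xt]; split=> //.
  by apply: card_lt_le_trans xt _; exact/seg_le/thetabar_le.
pose y c := xget set0
  [set y | Psmall (seg kappa) (cofbar kappa (NSt i)) y /\ u y = c].
exists (fun c => \bigcup_(B in y c) B); split=> [c|X /Ycov[z Yz Xz]].
  have [_ _ _ _ H] := NSt_ideal i; apply: H; rewrite /y.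
  case: xgetP => [z _ [[zY zk] _]|_].
    by split=> //; exact: subset_trans YJ.
  by split=> //; exact: finite_card_lt (finite_set0 _) kappa_inf.
exists (u z); first exact: ul.
suff -> : y (u z) = z by [].
rewrite /y; case: xgetP => [w _ [Yw /uinj]|/(_ z) []]; first exact.
by split.
Qed.

End Decomposition.

(** [h i] is the index of a set covering the part caught at [i].  The null set
    consists of the unguarded [a] and of those caught by a set whose index they
    contain; the latter is a diagonal union over the indices. *)
Lemma NS_representation : exists2 N, NS kappa lambda lambda theta N &
  forall A, NS kappa lambda lambda theta A -> exists h : T -> T,
    (forall i, h i < lambda) /\
    forall a, A a -> ~ N a -> exists i, [/\ i < mu, a i & ~ a (h i)].
Proof.
have [g [gl gcof]] := cofinal_fun Twf mu_lambda.
have /choice[tau tauP] i : exists t,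
    [/\ is_cardinal t, Order.max (g i) mu < t & t < lambda].
  by apply: lambda_limit => //; rewrite gt_max gl.
have tau_card i : is_cardinal (tau i) by have [] := tauP i.
have mu_tau i : mu < tau i by have [_] := tauP i; rewrite gt_max => /andP[].
have tau_lambda i : tau i < lambda by have [] := tauP i.
have tau_cof y : y < lambda -> exists2 i, i < mu & y <= tau i.
  move=> /gcof[i imu yi]; exists i => //; apply: le_trans yi _; apply: ltW.
  by have [_] := tauP i; rewrite gt_max => /andP[].
have kl : kappa <= lambda by exact: le_trans kappa_mu (ltW mu_lambda).
have NSl_normal :
    normal_ideal kappa lambda lambda theta (NS kappa lambda lambda theta).
  by apply: NS_normal_ideal; apply: NS_exist => //; rewrite kl lexx.
have NSl_ideal := NSl_normal.1.
have /choice[Z ZP] := @NSt_enumeration tau tau_card mu_tau tau_lambda.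
exists ([set a | Pks kappa lambda a /\ ~ guarded tau a] `|`
  [set a | Pks kappa lambda a /\ exists2 c, a c &
    (Pks kappa lambda a /\ caught tau (Z ^~ c) a)]).
  apply: (ideal_setU NSl_ideal); first exact: unguarded_null.
  apply: (normal_diagonal1 kl NSl_normal
    (X := fun c => [set a | Pks kappa lambda a /\ caught tau (Z ^~ c) a])).
  by move=> c _; apply: caught_null => // i _; exact: (ZP i).1.
move=> A NA; have := NA.
rewrite (NS_assembledE tau_card mu_tau tau_lambda tau_cof) => -[AP [X NX AX]].
have /choice[h hP] i : exists c, c < lambda /\ (i < mu -> X i `<=` Z i c).
  have [imu|nimu] := pselect (i < mu); last by exists mu.
  by have [c cl Xc] := (ZP i).2 _ (NX i imu); exists c.
exists h; split=> [i|a Aa nNa]; first exact: (hP i).1.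
have Pa := AP _ Aa; have ga : guarded tau a.
  by apply: contrapT => nga; apply: nNa; left.
have [i [imu ai Xi]] := AX a Aa ga; exists i; split=> // ahi.
apply: nNa; right; split=> //; exists (h i) => //; split=> //.
by exists i; split=> //; exact: (hP i).2.
Qed.

End SingularCardinal.

(** * Nowhere precipitousness *)

Theorem proposition3p2 (d : Order.disp_t) (T : orderType d)
    (Twf : well_order (<=%O : rel T))
    (kappa lambda theta : T)
    (kappa_regular : regular_cardinal kappa)
    (kappa_uncountable : ~ countable (seg kappa))
    (lambda_singular : singular_cardinal lambda)
    (cof_lambda : kappa <= cof lambda)
    (theta_cardinal : is_cardinal theta)
    (theta_ge2 : `I_2 #<= seg theta)
    (theta_le : theta <= kappa)
    (NS_exist : forall tau : T, is_cardinal tau -> kappa <= tau <= lambda ->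
       exists J, normal_ideal kappa tau tau theta J)
    (small_exp : forall tau : T, is_cardinal tau -> kappa <= tau < lambda ->
       cexp (seg tau) (seg (cof lambda)) #< seg lambda)
    (small_cof : forall tau : T, is_cardinal tau -> kappa <= tau < lambda ->
       cofbar kappa (NS kappa tau tau theta)
         #<= Psmall (seg (thetabar kappa theta)) (seg lambda)) :
  nowhere_precipitous kappa lambda (NS kappa lambda lambda theta).
Proof.
have [[kappa_card kappa_inf] _] := kappa_regular.
have [[lambda_card _] mu_lambda] := lambda_singular.
set J := NS kappa lambda lambda theta.
have Jnormal : normal_ideal kappa lambda lambda theta J.
  apply: NS_normal_ideal; apply: NS_exist => //.
  by rewrite lexx (le_trans cof_lambda (ltW mu_lambda)).
have Jideal := Jnormal.1.
have [N JN repr] := NS_representation Twf kappa_inf theta_ge2 theta_le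
  cof_lambda mu_lambda lambda_card kappa_card small_exp NS_exist small_cof.
have [lt [ltmin lttot]] := strict_well_order (set T).
move=> A [AP nJA] prec.
have JAE (B : set (set T)) : B `<=` Pks kappa lambda ->
    restrict_ideal kappa lambda (restrict_ideal kappa lambda J A) A B <->
    J (B `&` A).
  move=> BP; split=> [[_ [_ JBA]]|JBA].
    by apply: (ideal_sub Jideal JBA) => a [].
  split=> //; split; first by move=> a [/BP].
  by apply: (ideal_sub Jideal JBA) => a [[]].
have Apos : positive kappa lambda (restrict_ideal kappa lambda J A) A.
  by split=> // -[_ JAA]; apply: nJA; apply: (ideal_sub Jideal JAA).
have [|||||Q [Qmax Qref Qbranch]] :=
  @antichains_without_branch _ _ kappa lambda
    (restrict_ideal kappa lambda (restrict_ideal kappa lambda J A) A)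
    _ _ _ lt ltmin (tame kappa lambda (W := set T)).
- move=> B C [BP [BA JB]] CB; split; first exact: subset_trans BP.
  split; first by apply: subset_trans BA => a [/CB].
  by apply: (ideal_sub Jideal JB) => a [[/CB]].
- move=> /(JAE _ (@subset_refl _ _)) JPA; apply: nJA.
  by apply: (ideal_sub Jideal JPA) => a Aa; split=> //; exact: AP.
- by move=> B B' r; exact: tame_sub.
- (* ranks are sets here: the identity is injective, hence tame *)
  by exists id; apply: tame_injective.
- move=> B r [BP nJB] Br.
  have BApos : positive kappa lambda J (B `&` A).
    by split=> [a [/BP]//|JBA]; apply: nJB; apply/JAE.
  have BAr : tame kappa lambda (B `&` A) r by apply: tame_sub Br => a [].
  have := tame_descent Twf kappa_inf theta_ge2 theta_le cof_lambda mu_lambda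
    lambda_card kappa_card small_exp Jnormal JN repr ltmin lttot BApos BAr.
  move=> [B' [r' [B'BA [B'P nJB'] B'r' lt_r']]].
  exists B', r'; split=> //; first by move=> a /B'BA[].
  split=> // /(JAE _ B'P) JB'; apply: nJB'; apply: (ideal_sub Jideal JB').
  by move=> a B'a; split=> //; exact: (B'BA _ B'a).2.
have [f [Qf fdec fne]] := prec A Q Apos Qmax Qref.
exact: Qbranch f Qf fdec fne.
Qed.
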